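(* Let $n\geq 3$ be odd and let $C_n$ be the cycle on $n$ vertices. Then $b_2(C_n)=\frac{n+1}{2}$.
   Context: For a finite simple graph $G=(V,E)$, a biclique on a subset of $V$ is given by two disjoint sets $X,Y\subseteq V$; its edges are all pairs $\{x,y\}$ with $x\in X$, $y\in Y$. An odd cover of $G$ is a collection of bicliques on subsets of $V$ such that every pair of vertices adjacent in $G$ is an edge of an odd number of the bicliques, and every pair of distinct non-adjacent vertices is an edge of an even number of the bicliques. $b_2(G)$ denotes the minimum cardinality of an odd cover of $G$. *)

(* Defs.v *)
From mathcomp Require Import all_boot.

Set Implicit Arguments.
Unset Strict Implicit.
Unset Printing Implicit Defensive.

Record sgraph := SGraph {
  vertex :> finType;
  adj : rel vertex;
  adj_sym : symmetric adj;
  adj_irrefl : irreflexive adj }.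

(* Either side may be empty; such a biclique has no edges. *)
Definition biclique (V : finType) : finType :=
  {B : {set V} * {set V} | [disjoint B.1 & B.2]}.

Definition bedge (V : finType) (B : biclique V) (x y : V) : bool :=
  let: (X, Y) := val B in
  ((x \in X) && (y \in Y)) || ((y \in X) && (x \in Y)).

(* Collections are lists, so repetitions are allowed; deleting two equal
   bicliques preserves all parities, so this does not affect the minimum. *)
Definition odd_cover (G : sgraph) (s : seq (biclique G)) : bool :=
  [forall x : G, forall y : G, (x != y) ==>
     (odd (count (fun B => bedge B x y) s) == adj x y)].

Lemma odd_cover_exists (G : sgraph) :
  exists k, [exists s : k.-tuple (biclique G), odd_cover s].
Proof.
have disj0 : [disjoint (set0 : {set G}) & (set0 : {set G})].
  by rewrite -setI_eq0 setI0.
pose b0 : biclique G := exist _ (set0, set0) disj0.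
pose single (p : G * G) : biclique G := insubd b0 ([set p.1], [set p.2]).
have singleE p : p.1 != p.2 -> val (single p) = ([set p.1], [set p.2]).
  by move=> np; rewrite val_insubd /= disjoints1 inE np.
pose E := [seq p <- enum {: G * G} |
             adj p.1 p.2 && (enum_rank p.1 < enum_rank p.2)].
exists (size (map single E)); apply/existsP; exists (in_tuple (map single E)).
apply/forallP => x; apply/forallP => y; apply/implyP => nxy /=; apply/eqP.
wlog lxy : x y nxy / enum_rank x < enum_rank y.
  move=> IH; case: (ltngtP (enum_rank x) (enum_rank y)) => [|lyx|exy].
  - exact: IH.
  - rewrite adj_sym -IH // 1?eq_sym //; congr odd; apply: eq_count => B.
    by rewrite /bedge; case: (val B) => X Y; rewrite orbC.
  - by move/val_inj/enum_rank_inj: exy nxy => ->; rewrite eqxx.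
rewrite count_map count_filter.
rewrite (@eq_count _ _ (fun p => adj x y && (p == (x, y)))); last first.
  move=> [u v]; rewrite /= /bedge xpair_eqE.
  have [auv|nauv] := boolP (adj u v); last first.
    rewrite andbF; apply/esym/negP => /andP[axy /andP[/eqP eu /eqP ev]].
    by move: nauv; rewrite eu ev axy.
  have nuv : u != v by apply: contraTneq auv => ->; rewrite adj_irrefl.
  rewrite singleE //= !inE.
  have swapF : (y == u) && (x == v) && (enum_rank u < enum_rank v) = false.
    apply/negP => /andP[/andP[/eqP <- /eqP <-]].
    by rewrite ltnNge ltnW.
  have [eu|nu] := eqVneq u x; have [ev|nv] := eqVneq v y; subst => //=;
    rewrite ?auv ?lxy ?andbF //.
have [axy|_] := boolP (adj x y); last by rewrite count_pred0.
by rewrite (@eq_count _ _ (pred1 (x, y))) // count_uniq_mem ?enum_uniq // mem_enum.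
Qed.

Definition b2 (G : sgraph) : nat := ex_minn (odd_cover_exists G).

Section Cycle.

Variable n : nat.

(* ordS is the successor modulo n. The condition i != j only matters for
   n = 1, where it rules out a loop. *)
Definition cycle_adj : rel 'I_n :=
  fun i j => (i != j) && ((j == ordS i) || (i == ordS j)).

Lemma cycle_adj_sym : symmetric cycle_adj.
Proof. by move=> i j; rewrite /cycle_adj eq_sym orbC. Qed.

Lemma cycle_adj_irrefl : irreflexive cycle_adj.
Proof. by move=> i; rewrite /cycle_adj eqxx. Qed.

Definition cycle_graph : sgraph := SGraph cycle_adj_sym cycle_adj_irrefl.

End Cycle.

(* Main.v *)
Require Import Defs.
From mathcomp Require Import all_boot.
From mathcomp Require Import all_algebra.

(** Upper bound: the stars centred at a vertex cover, with each edge inside the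
    cover assigned to one of its ends, form an odd cover; the even vertices of
    the cycle are a vertex cover of size (n + 1) / 2.

    Lower bound: with m bicliques, the adjacency matrix over F_2 is
    A = X Y^T + Y X^T, the columns of X and Y being the indicator vectors of
    the sides.  For n odd the kernel of A is spanned by the all-one vector u, so
    A has rank n - 1.  If 2 m <= n - 1, the stacked matrix (Y^T; X^T) must have
    independent rows, and u A = 0 then forces u X = u Y = 0.  Hence the number
    of edges, which modulo 2 is u X Y^T u^T since sides are disjoint, is even,
    while the cycle has n edges. *)

Set Implicit Arguments.
Unset Strict Implicit.
Unset Printing Implicit Defensive.

(** * Odd covers from vertex covers *)

Lemma b2_leq_vertex_cover (G : sgraph) (S : {set G}) :
  (forall x y : G, adj x y -> (x \in S) || (y \in S)) -> b2 G <= #|S|.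
Proof.
move=> coverS.
(* An edge with both ends in [S] goes to the end of smaller rank, so that exactly one star contains
   it. *)
pose nbr (v : G) : {set G} :=
  [set w | adj v w && ((w \notin S) || (enum_rank v < enum_rank w))].
have disj v : [disjoint [set v] & nbr v].
  by rewrite disjoints1 inE adj_irrefl.
pose star v : biclique G := exist _ ([set v], nbr v) (disj v).
rewrite /b2; case: ex_minnP => m _; apply.
rewrite cardE -(size_map star); apply/existsP; exists (in_tuple _).
apply/forallP => x; apply/forallP => y; apply/implyP => nxy /=; apply/eqP.
pose d v w := (v \in S) && (w \in nbr v).
have countE : count (fun B => bedge B x y) (map star (enum S)) = d x y + d y x.
  have sum_d u w : \sum_(v in S) (v == u) * (w \in nbr v) = d u w.
    rewrite big_mkcond (bigD1 u) //= eqxx mul1n big1 => [|v /negPf->]; last first.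
      by rewrite if_same.
    by rewrite addn0 /d; case: (u \in S).
  rewrite count_map -sum1_count big_mkcond big_enum -!sum_d -big_split /=.
  apply: eq_bigr => v _; rewrite /bedge /= ![_ \in [set v]]inE ![_ == v]eq_sym.
  have [->|_] := eqVneq v x; last first.
    by rewrite mul0n /=; case: (v == y); case: (x \in _).
  by rewrite (negPf nxy) mul1n orbF addn0; case: (y \in _).
rewrite countE oddD !oddb /d !inE [adj y x]adj_sym.
have [axy|] := boolP (adj x y); last by rewrite !andbF.
have := coverS _ _ axy.
case: (x \in S); case: (y \in S) => //= _.
by case: ltngtP => // /val_inj/enum_rank_inj exy; rewrite exy eqxx in nxy.
Qed.

(** * Parity and successors on an odd cycle *)

Lemma odd_halfE n : odd n -> n = n./2.*2.+1.
Proof. by move=> n_odd; rewrite -{1}(odd_double_half n) n_odd. Qed.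

Lemma card_even_ord n : odd n -> #|[set i : 'I_n | ~~ odd i]| = n./2.+1.
Proof.
move/odd_halfE; move: n./2 => k ->.
rewrite -sum1_card (eq_bigl (fun i : 'I_k.*2.+1 => ~~ odd i)) => [|i]; last first.
  by rewrite inE.
rewrite big_mkcond /=; elim: k => [|k IH]; first by rewrite big_ord1.
by rewrite doubleS 2!big_ord_recr /= IH odd_double /= addn0 addn1.
Qed.

Lemma val_iter_ordS n (i : 'I_n) m : val (iter m (@ordS n) i) = (i + m) %% n.
Proof.
elim: m => [|m IH]; first by rewrite addn0 modn_small.
by rewrite iterS /= IH -addn1 modnDml addn1 addnS.
Qed.

(** This makes the even vertices a vertex cover of an odd cycle: the closing edge joins [n - 1] and
    [0], both even. *)
Lemma odd_ordS n (i : 'I_n) : odd n -> odd i -> ~~ odd (ordS i).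
Proof.
move=> n_odd i_odd /=; case: (ltngtP i.+1 n) (ltn_ord i) => // [lt_Si|->] _.
  by rewrite modn_small //= i_odd.
by rewrite modnn.
Qed.

Lemma ordS_neq n (i : 'I_n) : 1 < n -> ordS i != i.
Proof.
move=> n_gt1; apply/eqP => /(congr1 val) /= e.
have : i + 1 == i + 0 %[mod n] by rewrite addn1 addn0 e modn_small.
by rewrite eqn_modDl mod0n modn_small.
Qed.

Lemma ordS_ordS_neq n (i : 'I_n) : 2 < n -> ordS (ordS i) != i.
Proof.
move=> n_gt2; apply/eqP => /(congr1 val); rewrite (val_iter_ordS i 2) => e.
have : i + 2 == i + 0 %[mod n] by rewrite addn0 e modn_small.
by rewrite eqn_modDl mod0n modn_small.
Qed.

Lemma ordS2_invariant_const n (T : Type) (f : 'I_n -> T) : odd n ->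
  (forall i, f (ordS (ordS i)) = f i) -> forall i j, f i = f j.
Proof.
move=> n_odd f2.
have fiter m i : f (iter m.*2 (@ordS n) i) = f i.
  by elim: m => // m IH; rewrite doubleS !iterS f2.
suff lej (i j : 'I_n) : i <= j -> f i = f j.
  by move=> i j; have [/lej//|/ltnW/lej] := leqP i j.
(* The difference is made even by going once more around the odd cycle. *)
move=> le_ij; set m := j - i; set m' := if odd m then m + n else m.
rewrite -(fiter m'./2 i); congr f; apply: val_inj; rewrite val_iter_ordS.
have -> : m'./2.*2 = m'.
  have: odd m' = false by rewrite /m'; case: ifP; rewrite ?oddD ?n_odd => // ->.
  by rewrite -{3}(odd_double_half m') => ->.
rewrite /m'; case: ifP => _; rewrite ?addnA ?modnDr subnKC // modn_small //.
Qed.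

(** * Matrices of the cycle and the lower bound *)

Import GRing.Theory.
Local Open Scope ring_scope.

Section Shift.

Variables (n : nat) (F : fieldType).

(** The cycle with its edges oriented, each listed once; for [n > 2], adding the transpose gives the
    adjacency matrix. *)
Definition shiftmx : 'M[F]_n := \matrix_(i, j) (j == ordS i)%:R.

Lemma mul_shiftmx_ordS (v : 'rV_n) j : (v *m shiftmx) 0 (ordS j) = v 0 j.
Proof.
rewrite mxE (bigD1 j) //= mxE eqxx mulr1 big1 ?addr0 // => i ij.
rewrite mxE; case: eqP => [/(can_inj (@ordSK n)) e|]; last by rewrite mulr0.
by rewrite e eqxx in ij.
Qed.

Lemma mul_tr_shiftmx (v : 'rV_n) j : (v *m shiftmx^T) 0 j = v 0 (ordS j).
Proof.
rewrite mxE (bigD1 (ordS j)) //= !mxE eqxx mulr1 big1 ?addr0 // => i ij.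
by rewrite !mxE (negPf ij) mulr0.
Qed.

End Shift.

Lemma rank_cycle_adjmx n : odd n ->
  (n.-1 <= \rank (shiftmx n 'F_2 + (shiftmx n 'F_2)^T)%R)%N.
Proof.
move=> n_odd; set A := (_ + _)%R.
have : (kermx A <= (const_mx 1 : 'rV_n))%MS.
  apply/row_subP => r; have : row r (kermx A) *m A = 0.
    by apply/sub_kermxP/row_sub.
  move: (row r _) => v vA0.
  (* Entry [ordS j] of [v *m A] is the sum of the entries of [v] at the two neighbours of [ordS j];
     in characteristic 2 its vanishing makes them equal. *)
  have v2 j : v 0 (ordS (ordS j)) = v 0 j.
    move/rowP/(_ (ordS j))/eqP: vA0.
    rewrite mulmxDr mxE mul_shiftmx_ordS mul_tr_shiftmx mxE.
    by rewrite addr_eq0 oppr_pchar2 ?pchar_Fp // => /eqP.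
  have vE := ordS2_invariant_const n_odd v2.
  suff -> : v = v 0 r *: const_mx 1 by apply: scalemx_sub.
  by apply/rowP => j; rewrite [RHS]mxE [const_mx _ _ _]mxE mulr1 (vE j r).
move/mxrankS; rewrite mxrank_ker => /leq_trans/(_ (rank_leq_row _)).
by rewrite leq_subLR -subn1 leq_subLR addnC.
Qed.

(** Each entry below the diagonal is moved to its mirror position. Hence zero-diagonal matrices with
    the same [P + P^T] have the same total, which allows [C] to be traded for [X *m Y^T]. *)
Lemma sum_mx_zero_diag (R : nmodType) n (P : 'M[R]_n) : (forall i, P i i = 0) ->
  \sum_i \sum_j P i j = \sum_(i < n) \sum_(j < n | (i < j)%N) (P + P^T) i j.
Proof.
move=> P0.
have -> : \sum_i \sum_j P i j =
    \sum_(i < n) (\sum_(j < n | (i < j)%N) P i j + \sum_(j < n | (j < i)%N) P i j).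
  apply: eq_bigr => i _; rewrite (bigD1 i) //= P0 add0r.
  rewrite (bigID (fun j : 'I_n => (i < j)%N)) /=; congr (_ + _);
    apply: eq_bigl => j; rewrite -val_eqE /=; by case: ltngtP.
rewrite big_split /= [X in _ + X](exchange_big_dep predT) //= -big_split /=.
apply: eq_bigr => i _; rewrite -big_split /=.
by apply: eq_bigr => j _; rewrite !mxE.
Qed.

Lemma sum_mulmx (R : pzSemiRingType) n m (X : 'M[R]_(n, m)) (Y : 'M[R]_(m, n)) :
  const_mx 1 *m X = 0 :> 'rV_m -> \sum_i \sum_j (X *m Y) i j = 0.
Proof.
move=> uX; rewrite exchange_big big1 // => j _.
have /rowP/(_ j) : (const_mx 1 : 'rV_n) *m (X *m Y) = 0 by rewrite mulmxA uX mul0mx.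
rewrite [RHS]mxE => uXY0; rewrite -[RHS]uXY0 [RHS]mxE.
by apply: eq_bigr => i _; rewrite [const_mx _ _ _]mxE mul1r.
Qed.

Lemma odd_cover_cycle_size n (s : seq (biclique (cycle_graph n))) :
  (2 < n)%N -> odd n -> odd_cover s -> (n < (size s).*2)%N.
Proof.
move=> n_gt2 n_odd s_cover; rewrite ltnNge; apply/negP => s_small.
have chF2 : 2 \in [pchar 'F_2] by exact: pchar_Fp.
set m := size s in s_small.
pose b (k : 'I_m) := val (tnth (in_tuple s) k).
pose X : 'M['F_2]_(n, m) := \matrix_(i, k) (i \in (b k).1)%:R.
pose Y : 'M['F_2]_(n, m) := \matrix_(i, k) (i \in (b k).2)%:R.
pose C := shiftmx n 'F_2.
have disj k (i : 'I_n) : (i \in (b k).1) && (i \in (b k).2) = false.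
  apply/negP => /andP[i1 i2].
  have d : [disjoint (b k).1 & (b k).2] by apply: (valP (tnth (in_tuple s) k)).
  by rewrite (disjointFr d i1) in i2.
have N0 i : (X *m Y^T) i i = 0.
  by rewrite mxE big1 // => k _; rewrite !mxE -natrM mulnb disj.
have C0 i : C i i = 0.
  by rewrite mxE eq_sym (negPf (ordS_neq i (ltnW n_gt2))).
have AE : X *m Y^T + (X *m Y^T)^T = C + C^T.
  apply/matrixP => i j; have [<-|ij] := eqVneq i j.
    have diag0 (P : 'M['F_2]_n) : P i i = 0 -> (P + P^T) i i = 0.
      by move=> P0; rewrite !mxE P0 addr0.
    by rewrite !diag0.
  have /forallP/(_ i)/forallP/(_ j) := s_cover; rewrite ij /= => /eqP count_s.
  have -> : (X *m Y^T + (X *m Y^T)^T) i j = (count (fun B => bedge B i j) s)%:R.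
    rewrite -sum1_count big_mkcond (big_tnth _ _ s) natr_sum !mxE -big_split /=.
    apply: eq_bigr => k _; rewrite !mxE -!natrM -natrD !mulnb /bedge.
    (* Disjoint sides keep the two disjuncts of [bedge] from holding together, so their sum is 0 or
       1. *)
    move: (disj k i) (disj k j); rewrite /b; case: (val _) => X' Y' /=.
    by do 4!case: (_ \in _).
  have -> : (C + C^T) i j = (cycle_adj i j)%:R.
    rewrite !mxE -natrD /cycle_adj ij /=.
    have [->|_] := eqVneq j (ordS i); last by case: eqP.
    by rewrite eq_sym (negPf (ordS_ordS_neq _ n_gt2)).
  by rewrite -[cycle_adj i j]count_s -modn2 GRing.natr_mod_pchar.
(* Contradiction: this total is also [n], which is nonzero modulo 2. *)
have : \sum_i \sum_j C i j = 0.
  rewrite (sum_mx_zero_diag C0) -AE -(sum_mx_zero_diag N0) sum_mulmx //.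
  pose D := col_mx Y^T X^T.
  have AD : C + C^T = row_mx X Y *m D.
    by rewrite mul_row_col -AE trmx_mul trmxK.
  have D_free : row_free D.
    rewrite /row_free eqn_leq rank_leq_row /=.
    have : (n.-1 <= \rank D)%N.
      by rewrite (leq_trans (rank_cycle_adjmx n_odd)) // -/C AD mxrankM_maxr.
    (* Since [n] is odd, [m.*2 <= n] sharpens to [m.*2 <= n.-1], so [D] has full row rank. *)
    apply: leq_trans; rewrite addnn -ltnS prednK ?(ltnW (ltnW n_gt2)) //.
    rewrite ltn_neqAle s_small andbT.
    by apply: contraTneq n_odd => <-; rewrite odd_double.
  (* Each column of [C + C^T] sums to 1 + 1 = 0, and the row-free factor [D] cancels on the
     right. *)
  have : (const_mx 1 : 'rV_n) *m row_mx X Y = 0.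
    apply: (row_free_inj D_free); rewrite mul0mx -mulmxA -AD.
    apply/rowP => j; rewrite mulmxDr mxE -(ord_predK j) mul_shiftmx_ordS.
    rewrite mul_tr_shiftmx !mxE.
    by rewrite (addrr_pchar2 chF2).
  by rewrite mul_mx_row => /eqP; rewrite row_mx_eq0 => /andP[/eqP].
rewrite (eq_bigr (fun=> 1)) => [|i _]; last first.
  rewrite (bigD1 (ordS i)) //= mxE eqxx big1 ?addr0 // => j ij.
  by rewrite mxE (negPf ij).
rewrite sumr_const card_ord => /eqP; rewrite -(dvdn_pcharf chF2).
by rewrite dvdn2 n_odd.
Qed.

Local Close Scope ring_scope.

Theorem theorem5p1 (n : nat) (n_ge3 : 3 <= n) (n_odd : odd n) :
  b2 (cycle_graph n) = (n + 1) %/ 2.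
Proof.
have nE := odd_halfE n_odd.
have -> : (n + 1) %/ 2 = n./2.+1 by rewrite divn2 addn1 {1}nE -doubleS doubleK.
apply/eqP; rewrite eqn_leq; apply/andP; split.
  pose S : {set cycle_graph n} := [set i : 'I_n | ~~ odd i].
  rewrite -(card_even_ord n_odd : #|S| = _); apply: b2_leq_vertex_cover => x y.
  rewrite !inE -negb_and => /andP[_ /orP[]/eqP->]; apply/andP => -[].
    by move=> odd_x; apply/negP/odd_ordS.
  by move=> + odd_y; apply/negP/odd_ordS.
rewrite /b2; case: ex_minnP => m /existsP[s /(odd_cover_cycle_size n_ge3 n_odd)].
by rewrite size_tuple {1}nE => + _; rewrite -doubleS leq_double.
Qed.
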